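(* Let $G$ be a finite group, $m>1$, and $\Gamma=\mathrm{Cay}(G,S_{i,j}:1\le i,j\le m)$ an $m$-PCayley digraph of $G$. Then $\Gamma$ is K$m$PCI if and only if $N_{\mathrm{Aut}(\Gamma)}(R(G))$ induces the full symmetric group on $\mathcal{G}=\{G_1,\dots,G_m\}$ and every semiregular subgroup of $\mathrm{Aut}(\Gamma)$ which is isomorphic to $G$ and has orbit set $\mathcal{G}$ is conjugate to $R(G)$ in $\mathrm{Aut}(\Gamma)$.
   Context: For subsets $S_{i,j}\subseteq G$, $\mathrm{Cay}(G,S_{i,j}:1\le i,j\le m)$ is the digraph with vertex set $\bigcup_i G_i$, $G_i=\{x_i:x\in G\}$, and arcs $(x_i,(sx)_j)$ for $s\in S_{i,j}$, $x\in G$; it is an $m$-PCayley digraph of $G$ if $S_{i,i}=\emptyset$ for all $i$ (all on the same vertex set). $R(g):x_i\mapsto(xg)_i$, $R(G)=\{R(g)\}$, with orbit set $\mathcal{G}$. A permutation group is semiregular if all point stabilizers are trivial. $N$ is the normalizer of $R(G)$ in the symmetric group on the vertex set and $K$ the kernel of $N$ acting on $\mathcal{G}$. $\Gamma$ is K$m$PCI if for every $m$-PCayley digraph $\Sigma$ of $G$ such that some isomorphism $\Gamma\to\Sigma$ maps $\mathcal{G}$ to itself, there exists $k\in K$ with $\Gamma^k=\Sigma$. *)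

(* Defs.v *)
From HB Require Import structures.
From mathcomp Require Import all_boot all_fingroup.

Set Implicit Arguments.
Unset Strict Implicit.
Unset Printing Implicit Defensive.

Import GroupScope.

(* Digraphs on a finite vertex type T are arc sets; permutations act on the
   right, so D ^ p has the arcs (p u, p v) for (u, v) an arc of D. *)
Notation digraph T := {set T * T}.

Definition digraph_act (T : finType) (D : digraph T) (p : {perm T}) :
  digraph T := [set (p a.1, p a.2) | a in D].

Definition digraph_iso (T : finType) (D E : digraph T) (p : {perm T}) : Prop :=
  forall u v : T, ((p u, p v) \in E) = ((u, v) \in D).

Definition digraph_aut (T : finType) (D : digraph T) : {set {perm T}} :=
  [set p : {perm T} |
    [forall u, forall v, ((p u, p v) \in D) == ((u, v) \in D)]].

Lemma digraph_autP (T : finType) (D : digraph T) (p : {perm T}) :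
  reflect (digraph_iso D D p) (p \in digraph_aut D).
Proof.
rewrite inE; apply: (iffP forallP) => [h u v | h u].
  by move/forallP: (h u) => /(_ v)/eqP.
by apply/forallP => v; rewrite h.
Qed.

Fact digraph_aut_group_set (T : finType) (D : digraph T) :
  group_set (digraph_aut D).
Proof.
apply/group_setP; split=> [|p q /digraph_autP hp /digraph_autP hq].
  by apply/digraph_autP => u v; rewrite !perm1.
by apply/digraph_autP => u v; rewrite !permM hq hp.
Qed.

Canonical digraph_aut_group (T : finType) (D : digraph T) :=
  Group (digraph_aut_group_set D).

Definition semiregular_perm (T : finType) (H : {set {perm T}}) : Prop :=
  forall v : T, 'C_H[v | 'P] = 1.

Definition orbit_set (T : finType) (H : {set {perm T}}) : {set {set T}} :=
  [set orbit 'P H v | v in [set: T]].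

(* The permutation group on the set B of blocks induced by those elements of A
   that preserve B, as a group of permutations of {set T} supported on B. *)
Definition induced_on (T : finType) (A : {set {perm T}}) (B : {set {set T}}) :
  {set {perm {set T}}} := restr_perm B @* (actperm 'P^* @* A).

(* x_i is the pair (x, i). *)
Notation vertex gT m := (gT * 'I_m)%type.

Definition Cay (gT : finGroupType) (m : nat) (S : 'I_m -> 'I_m -> {set gT}) :
  digraph (vertex gT m) :=
  \bigcup_(i : 'I_m) \bigcup_(j : 'I_m)
    [set ((x, i), (s * x, j)) | s in S i j, x in [set: gT]].

Definition is_PCayley (gT : finGroupType) (m : nat)
    (D : digraph (vertex gT m)) : Prop :=
  exists2 S : 'I_m -> 'I_m -> {set gT}, forall i, S i i = set0 & D = Cay S.

Definition Rfun (gT : finGroupType) (m : nat) (g : gT) (v : vertex gT m) :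
  vertex gT m := (v.1 * g, v.2).

Fact Rfun_inj (gT : finGroupType) (m : nat) (g : gT) :
  injective (@Rfun gT m g).
Proof. by move=> [x i] [y j] [/mulIg -> ->]. Qed.

Definition Rperm (gT : finGroupType) (m : nat) (g : gT) :
  {perm vertex gT m} := perm (@Rfun_inj gT m g).

Definition RG (gT : finGroupType) (m : nat) : {set {perm vertex gT m}} :=
  [set Rperm m g | g in [set: gT]].

Fact RG_group_set (gT : finGroupType) (m : nat) : group_set (RG gT m).
Proof.
apply/group_setP; split=> [|_ _ /imsetP[g _ ->] /imsetP[h _ ->]].
  apply/imsetP; exists 1 => //; apply/permP=> -[x i].
  by rewrite perm1 permE /Rfun mulg1.
apply/imsetP; exists (g * h) => //; apply/permP=> -[x i].
by rewrite permM !permE /Rfun mulgA.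
Qed.

Canonical RG_group (gT : finGroupType) (m : nat) := Group (RG_group_set gT m).

Definition part (gT : finGroupType) (m : nat) (i : 'I_m) :
  {set vertex gT m} := [set (x, i) | x in [set: gT]].

Definition calG (gT : finGroupType) (m : nat) : {set {set vertex gT m}} :=
  orbit_set (RG gT m).

Lemma orbit_RG (gT : finGroupType) (m : nat) (x : gT) (i : 'I_m) :
  orbit 'P (RG gT m) (x, i) = part gT i.
Proof.
apply/setP=> v; apply/imsetP/imsetP => [[_ /imsetP[g _ ->] ->]|[y _ ->]].
  by exists (x * g) => //; rewrite /= apermE permE.
exists (Rperm m (x^-1 * y)); first by apply: imset_f; rewrite inE.
by rewrite /= apermE permE /Rfun /= mulKVg.
Qed.

Lemma calGE (gT : finGroupType) (m : nat) :
  calG gT m = [set part gT i | i in [set: 'I_m]].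
Proof.
apply/setP=> B; apply/imsetP/imsetP => [[[x i] _ ->]|[i _ ->]].
  by exists i => //; rewrite orbit_RG.
by exists (1, i) => //; rewrite orbit_RG.
Qed.

Definition normR (gT : finGroupType) (m : nat) : {set {perm vertex gT m}} :=
  'N(RG gT m).

Definition kerR (gT : finGroupType) (m : nat) : {set {perm vertex gT m}} :=
  'C_(normR gT m)(calG gT m | 'P^*).

Definition KmPCI (gT : finGroupType) (m : nat)
    (Gamma : digraph (vertex gT m)) : Prop :=
  forall Sigma : digraph (vertex gT m), is_PCayley Sigma ->
    (exists2 p : {perm vertex gT m}, digraph_iso Gamma Sigma p
       & [set p @: B | B : {set vertex gT m} in calG gT m] = calG gT m) ->
    exists2 k, k \in kerR gT m & digraph_act Gamma k = Sigma.

(* Main.v *)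
Require Import Defs.
From HB Require Import structures.
From mathcomp Require Import all_boot all_fingroup.

Set Implicit Arguments.
Unset Strict Implicit.
Unset Printing Implicit Defensive.

Import GroupScope.

(** A digraph [D] on the vertices is m-PCayley exactly when [RG] acts on it and
    no arc joins two vertices of one part.  Both properties survive relabelling
    by a permutation [p] that preserves the parts, as soon as [RG :^ p^-1] is a
    group of automorphisms.  Forwards, apply KmPCI to the relabelling of [Gamma]
    by [(x, i) |-> (x, s i)], and by the inverse of a permutation
    conjugating [RG] to a given semiregular group.  Backwards, an isomorphism
    [p] pulls [RG] back to a semiregular group; conjugacy corrects [p] to an
    element of the normalizer, and the full symmetric action then corrects it
    to an element of the kernel. *)

(** * Relabelling digraphs, orbits and semiregular groups by a permutation *)

Section DigraphAction.

Variable T : finType.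
Implicit Types (D E : digraph T) (p q : {perm T}) (H : {group {perm T}}).

Lemma mem_digraph_act D p u v :
  ((p u, p v) \in digraph_act D p) = ((u, v) \in D).
Proof.
apply/imsetP/idP => [[[a b] Dab /= [/perm_inj-> /perm_inj->]] //|Duv].
by exists (u, v).
Qed.

Lemma digraph_isoP D E p : digraph_iso D E p <-> digraph_act D p = E.
Proof.
split=> [pDE|<- u v]; last exact: mem_digraph_act.
apply/setP=> -[u v]; rewrite -(permKV p u) -(permKV p v).
by rewrite mem_digraph_act pDE.
Qed.

Lemma digraph_act1 D : digraph_act D 1 = D.
Proof. by apply/digraph_isoP => u v; rewrite !perm1. Qed.

Lemma digraph_actM D p q :
  digraph_act D (p * q) = digraph_act (digraph_act D p) q.
Proof. by apply/digraph_isoP => u v; rewrite !permM !mem_digraph_act. Qed.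

Lemma mem_digraph_aut D p : (p \in digraph_aut D) = (digraph_act D p == D).
Proof. by apply/digraph_autP/eqP => /digraph_isoP. Qed.

Lemma digraph_aut_act D p :
  digraph_aut (digraph_act D p) = digraph_aut D :^ p.
Proof.
apply/setP=> q; rewrite mem_conjg !mem_digraph_aut conjgE invgK.
rewrite mulgA 2!digraph_actM; apply/eqP/eqP => [->|{2}<-].
  by rewrite -digraph_actM mulgV digraph_act1.
by rewrite -[in RHS]digraph_actM mulVg digraph_act1.
Qed.

Lemma imset_permK p : cancel (fun A : {set T} => p @: A) (fun A => p^-1 @: A).
Proof. by move=> A; rewrite -imset_comp (eq_imset _ (permK p)) imset_id. Qed.

Lemma imset_permV_stable p (P : {set {set T}}) :
  [set p @: B | B : {set T} in P] = P -> [set p^-1 @: B | B : {set T} in P] = P.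
Proof.
move=> pP; rewrite -{1}pP -imset_comp -[RHS]imset_id.
exact/eq_imset/imset_permK.
Qed.

Lemma orbit_conjg H p v : orbit 'P (H :^ p) (p v) = p @: orbit 'P H v.
Proof.
apply/setP=> w.
apply/imsetP/imsetP => [[_ /imsetP[h Hh ->] ->]|[_ /imsetP[h Hh ->] ->]].
  by exists (h v); rewrite /= ?apermE ?permJ //; apply/imsetP; exists h.
by exists (h ^ p); rewrite ?memJ_conjg //= !apermE permJ.
Qed.

Lemma orbit_set_conjg H p :
  orbit_set (H :^ p) = [set p @: B | B : {set T} in orbit_set H].
Proof.
apply/setP=> B; apply/imsetP/imsetP => [[v _ ->]|[_ /imsetP[v _ ->] ->]].
  exists (orbit 'P H (p^-1 v)); first exact: imset_f.
  by rewrite -orbit_conjg permKV.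
by exists (p v); rewrite ?orbit_conjg.
Qed.

Lemma semiregular_permP H :
  semiregular_perm H <-> (forall h v, h \in H -> h v = v -> h = 1).
Proof.
split=> [Hreg h v Hh hv | Hreg v].
  by apply/set1P; rewrite -[[set 1]](Hreg v) inE Hh; apply/astab1P.
apply/trivgP/subsetP=> h /setIP[Hh /astab1P hv].
by apply/set1P/(Hreg h v).
Qed.

Lemma semiregular_perm_conjg H p :
  semiregular_perm H -> semiregular_perm (H :^ p).
Proof.
move/semiregular_permP=> Hreg; apply/(semiregular_permP (H :^ p)%G).
move=> _ v /imsetP[h Hh ->]; rewrite -{1 2}(permKV p v) permJ => /perm_inj.
by move/(Hreg h _ Hh)->; rewrite conj1g.
Qed.

End DigraphAction.

(** * Cayley structure on the parts, and the action of the normalizer of [RG] on them *)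

Section Parts.

Variables (gT : finGroupType) (m : nat).
Local Notation V := (vertex gT m).
Local Notation R := (RG gT m).
Implicit Types (D : digraph V) (p : {perm V}).

Lemma mem_part (v : V) (i : 'I_m) : (v \in part gT i) = (v.2 == i).
Proof.
case: v => x j; apply/imsetP/eqP => [[y _ [_ ->]] //|/= ->].
by exists x.
Qed.

Lemma part_inj : injective (@part gT m).
Proof.
by move=> i j /setP/(_ (1, i)); rewrite !mem_part eqxx => /esym/eqP.
Qed.

Lemma part_calG (i : 'I_m) : part gT i \in calG gT m.
Proof. by rewrite calGE imset_f. Qed.

Lemma calGP (B : {set V}) :
  reflect (exists i, B = part gT i) (B \in calG gT m).
Proof.
by rewrite calGE; apply: (iffP imsetP) => [[i]|[i]]; exists i.
Qed.

Lemma mem_Cay (S : 'I_m -> 'I_m -> {set gT}) x i y j :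
  (((x, i), (y, j)) \in Cay S) = (y * x^-1 \in S i j).
Proof.
apply/bigcupP/idP => [[i' _ /bigcupP[j' _ /imset2P[s z Ss _]]]|Sxy].
  by case=> -> -> -> ->; rewrite mulgK.
exists i => //; apply/bigcupP; exists j => //.
by apply/imset2P; exists (y * x^-1) x; rewrite ?mulgKV.
Qed.

Lemma is_PCayleyP D :
  is_PCayley D <->
  R \subset digraph_aut D /\ (forall u v, (u, v) \in D -> u.2 != v.2).
Proof.
split=> [[S S0 ->]|[RD D0]].
  split=> [|[x i] [y j]]; last first.
    by rewrite mem_Cay /=; case: eqP => // ->; rewrite S0 inE.
  apply/subsetP=> _ /imsetP[g _ ->]; apply/digraph_autP => -[x i] [y j].
  by rewrite !permE !mem_Cay invMg mulgA mulgK.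
(* The connection sets are read off from the arcs leaving [(1, i)]; right translation by [x] carries
   these to the arcs leaving [(x, i)]. *)
exists (fun i j => [set s | ((1, i), (s, j)) \in D]).
  by move=> i; apply/setP=> s; rewrite !inE; apply/negP=> /D0/eqP.
apply/setP=> -[[x i] [y j]]; rewrite mem_Cay inE.
have /digraph_autP/(_ (1, i) (y * x^-1, j)) : Rperm m x \in digraph_aut D.
  by apply: (subsetP RD); apply: imset_f.
by rewrite !permE /Rfun /= mul1g mulgKV.
Qed.

Lemma is_PCayley_act D p :
    is_PCayley D -> [set p @: B | B : {set V} in calG gT m] = calG gT m ->
  R :^ p^-1 \subset digraph_aut D -> is_PCayley (digraph_act D p).
Proof.
move=> /is_PCayleyP[_ D0] pG RD; apply/is_PCayleyP; split.
  by rewrite digraph_aut_act -sub_conjgV.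
move=> _ _ /imsetP[[u v] /= Duv [-> ->]].
apply: contra (D0 _ _ Duv) => /eqP puv.
(* The part containing both [p u] and [p v] is the image under [p] of a single part, which then
   contains both [u] and [v]. *)
have := part_calG (p v).2; rewrite -{1}pG => /imsetP[_ /calGP[i ->] pvE].
have /imsetP[u' iu' /perm_inj eu] : p u \in p @: part gT i.
  by rewrite -pvE mem_part puv.
have /imsetP[v' iv' /perm_inj ev] : p v \in p @: part gT i.
  by rewrite -pvE mem_part.
by move: iu' iv'; rewrite -eu -ev !mem_part => /eqP-> /eqP->.
Qed.

Lemma normR_calG p :
  p \in normR gT m -> [set p @: B | B : {set V} in calG gT m] = calG gT m.
Proof.
by move=> /normP Np; rewrite /calG -(orbit_set_conjg (RG_group gT m)) /= Np.
Qed.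

Lemma setactPE p (B : {set V}) : actperm 'P^* p B = p @: B.
Proof. by rewrite actpermE. Qed.

(** Guards against the default value of [restr_perm], which is the identity on permutations that do
    not stabilize the set. *)
Lemma normR_astabs p :
  p \in normR gT m -> actperm 'P^* p \in 'N(calG gT m | 'P).
Proof.
move/normR_calG=> pG; apply/astabsP => B /=; rewrite apermE setactPE.
by rewrite -{1}pG mem_imset //; apply/imset_inj/perm_inj.
Qed.

Lemma restr_normR p (B : {set V}) : p \in normR gT m -> B \in calG gT m ->
  restr_perm (calG gT m) (actperm 'P^* p) B = p @: B.
Proof.
by move=> Np GB; rewrite restr_permE ?setactPE ?normR_astabs.
Qed.

Lemma mem_induced_on (A : {group {perm V}}) t :
  reflect (exists2 p, p \in 'N_A(R) &
             t = restr_perm (calG gT m) (actperm 'P^* p))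
          (t \in induced_on 'N_A(R) (calG gT m)).
Proof.
apply: (iffP idP) => [/morphimP[_ _ /morphimP[p _ ANp ->] ->]|[p ANp ->]].
  by exists p.
have /setIP[_ Np] := ANp; apply: mem_morphim; first exact: normR_astabs.
by apply: mem_morphim; first rewrite inE.
Qed.

Lemma Rperm_inj : (0 < m)%N -> injective (@Rperm gT m).
Proof.
move=> m_gt0 g h /permP/(_ (1, Ordinal m_gt0)).
by rewrite !permE /Rfun /= !mul1g => -[].
Qed.

Lemma RpermM : {morph @Rperm gT m : g h / g * h}.
Proof.
by move=> g h; apply/permP=> -[x i]; rewrite permM !permE /Rfun /= mulgA.
Qed.

Lemma RG_isog : (0 < m)%N -> R \isog [set: gT].
Proof.
move=> m_gt0; rewrite isog_sym.
pose f := Morphism (in2W RpermM : {in [set: gT] &, _}).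
apply/(@isogP _ _ [set: gT]%G (RG_group gT m)); exists f.
  by apply/injmP => x y _ _ /Rperm_inj->.
by rewrite morphimEdom.
Qed.

Lemma RG_semiregular : semiregular_perm R.
Proof.
apply/(semiregular_permP (RG_group gT m)) => _ [x i] /imsetP[g _ ->].
rewrite permE => -[/(canRL (mulKg x))]; rewrite mulVg => ->.
by apply/permP=> -[y j]; rewrite perm1 permE /Rfun mulg1.
Qed.

(** * Permutations of the indices lifted to the vertices *)

Section Shift.

Variable s : 'I_m -> 'I_m.
Hypothesis s_inj : injective s.

Fact shift_fun_inj : injective (fun v : V => (v.1, s v.2)).
Proof. by move=> [x i] [y j] [/= -> /s_inj ->]. Qed.

Definition shift_perm : {perm V} := perm shift_fun_inj.

Lemma shift_perm_part i : shift_perm @: part gT i = part gT (s i).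
Proof.
apply/setP=> -[x j]; rewrite mem_part; apply/imsetP/eqP => [[[y k]]|/= ->].
  by rewrite mem_part permE => /eqP/= -> [_ ->].
by exists (x, i); rewrite ?mem_part ?permE.
Qed.

(** Changing only the index commutes with right translation, so the shift even centralizes [RG]. *)
Lemma shift_perm_normR : shift_perm \in normR gT m.
Proof.
apply/(subsetP (cent_sub _))/centP => _ /imsetP[g _ ->].
by apply/permP=> -[x i]; rewrite !permM !permE.
Qed.

End Shift.

(* Identify each part with [gT] through the [H]-orbit of its vertex [(1, i)]. *)
Lemma semiregular_conj_RG (H : {group {perm V}}) :
    semiregular_perm H -> H \isog [set: gT] -> orbit_set H = calG gT m ->
  exists p : {perm V}, R :^ p = H.
Proof.
move=> /semiregular_permP Hreg Hiso HG.
have orbH x i : orbit 'P H (x, i) = part gT i.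
  have : orbit 'P H (x, i) \in calG gT m by rewrite -HG imset_f.
  case/calGP=> j Ej; have := orbit_refl 'P H (x, i).
  by rewrite Ej mem_part => /eqP /= ->.
move: Hiso; rewrite isog_sym => /(@isogP _ _ [set: gT]%G) [f /injmP f_inj fG].
have Hf x : f x \in H by rewrite -fG mem_morphim ?inE.
have fpart x i : (f x (1, i)).2 = i.
  by apply/eqP; rewrite -mem_part -(orbH 1); apply: (mem_orbit 'P).
(* The index of [f x (1, i)] is [i], and semiregularity makes [f x] the only element of [H] with
   that value at [(1, i)]. *)
have p_inj : injective (fun v : V => f v.1 (1, v.2)).
  move=> [x i] [y j] /= fxy.
  have ij : j = i by rewrite -(fpart x i) fxy fpart.
  rewrite -ij in fxy *.
  congr pair; apply: f_inj; rewrite ?inE //.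
  apply/eqP; rewrite eq_mulgV1; apply/eqP; apply: (Hreg _ (1, j)).
    by rewrite groupM ?groupV.
  by rewrite permM fxy permK.
pose p := perm p_inj.
(* Since [f (x * g)] is [f x] followed by [f g], the map [p] turns right translation by [g] into
   [f g]. *)
have RpE g : Rperm m g ^ p = f g.
  apply/permP=> v; rewrite -(permKV p v) permJ; case: (p^-1 v) => x i.
  by rewrite !permE /= morphM ?inE // permM.
exists p; apply/setP=> h; rewrite -fG.
apply/imsetP/morphimP => [[_ /imsetP[g _ ->] ->]|[g _ _ ->]].
  by exists g; rewrite ?inE ?RpE.
by exists (Rperm m g); rewrite ?RpE ?imset_f.
Qed.

End Parts.

(** * The equivalence of KmPCI with the two conditions on automorphisms *)

Theorem theorem2p4 (gT : finGroupType) (m : nat)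
    (S : 'I_m -> 'I_m -> {set gT}) (m_gt1 : (1 < m)%N)
    (S_diag : forall i : 'I_m, S i i = set0) :
  KmPCI (Cay S) <->
  induced_on 'N_(digraph_aut (Cay S))(RG gT m) (calG gT m) = Sym (calG gT m) /\
  (forall H : {group {perm vertex gT m}},
     H \subset digraph_aut (Cay S) ->
     semiregular_perm H ->
     H \isog [set: gT] ->
     orbit_set H = calG gT m ->
     exists2 a, a \in digraph_aut (Cay S) & RG gT m :^ a = H).
Proof.
have PC : is_PCayley (Cay S) by exists S.
have /is_PCayleyP[RA _] := PC.
split=> [K | [fullSym conjR] Sigma PCS [p /digraph_isoP pS pG]].
- split=> [|H HA Hreg Hiso HG].
    apply/setP=> t; apply/mem_induced_on/idP => [[n _ ->]|].
      by rewrite inE restr_perm_on.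
    rewrite inE => tG.
    have /fin_all_exists[s ts] i : exists j, t (part gT i) = part gT j.
      by apply/calGP; rewrite (perm_closed _ tG) part_calG.
    have s_inj : injective s.
      move=> i j sij; apply: (@part_inj gT m); apply: (@perm_inj _ t).
      by rewrite !ts sij.
    pose q := shift_perm gT s_inj.
    have Nq : q \in normR gT m by apply: shift_perm_normR.
    have [||k /setIP[Nk Ck] kq] := K (digraph_act (Cay S) q).
    + apply: is_PCayley_act => //; first exact: normR_calG.
      by rewrite (normP (groupVr Nq)).
    + by exists q; [apply/digraph_isoP | apply: normR_calG].
    (* Both [q] and [k] carry the digraph to the same image, so [q * k^-1] is an automorphism; as
       [k] fixes every part, it moves the parts as [q] does, that is, as [t]. *)
    have Nqk : q * k^-1 \in normR gT m by rewrite groupM ?groupV.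
    exists (q * k^-1).
      rewrite inE Nqk mem_digraph_aut digraph_actM -kq -digraph_actM mulgV.
      by rewrite digraph_act1 eqxx.
    (* Outside the set of parts both permutations are the identity. *)
    apply/permP=> B; have [GB|GB] := boolP (B \in calG gT m); last first.
      by rewrite (out_perm tG) // (out_perm (restr_perm_on _ _)).
    rewrite restr_normR //; have /calGP[i ->] := GB.
    rewrite ts -[RHS]/('P^*%act _ _) actM.
    rewrite -[X in 'P^*%act X _]/(q @: part gT i) shift_perm_part.
    by rewrite (astab_act (groupVr Ck)) ?part_calG.
  have [p RpH] := semiregular_conj_RG Hreg Hiso HG.
  have VG : [set p^-1 @: B | B : {set vertex gT m} in calG gT m] = calG gT m.
    apply: imset_permV_stable.
    by rewrite -{2}HG -RpH (orbit_set_conjg (RG_group gT m)).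
  have [||k /setIP[/normP Nk _] kp] := K (digraph_act (Cay S) p^-1).
  + by apply: is_PCayley_act; rewrite ?invgK ?RpH.
  + by exists p^-1; first apply/digraph_isoP.
  (* [k] and [p^-1] have the same effect on the digraph, so [k * p] is an automorphism; as [k]
     normalizes [RG], conjugating by [k * p] has the same result as conjugating by [p]. *)
  exists (k * p); last by rewrite conjsgM Nk.
  by rewrite mem_digraph_aut digraph_actM kp -digraph_actM mulVg digraph_act1.
have [||||a Aa Ra] := conjR (RG_group gT m :^ p^-1)%G.
- have /is_PCayleyP[] := PCS; rewrite -pS digraph_aut_act => RS _.
  by rewrite /= sub_conjgV.
- exact/(@semiregular_perm_conjg _ (RG_group gT m))/RG_semiregular.
- apply: isog_trans (RG_isog _ (ltnW m_gt1)).
  by rewrite isog_sym; apply: conj_isog.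
- rewrite (orbit_set_conjg (RG_group gT m)); exact: imset_permV_stable.
(* [a] conjugates [RG] to its pullback along [p], and [p] brings the pullback back to [RG]. *)
have Nn : a * p \in normR gT m.
  by apply/normP; rewrite conjsgM Ra /= conjsgKV.
have : restr_perm (calG gT m) (actperm 'P^* (a * p)) \in Sym (calG gT m).
  by rewrite inE restr_perm_on.
rewrite -fullSym => /mem_induced_on[b /setIP[Ab Nb] /permP abE].
(* [b] permutes the parts as [a * p] does, so the quotient fixes each part; [a] and [b] preserve the
   digraph, so its image is that under [p], namely [Sigma]. *)
exists (b^-1 * (a * p)).
  rewrite inE groupM ?groupV //; apply/astabP => B GB.
  move: GB; rewrite -{1}(normR_calG Nb) => /imsetP[C GC ->].
  rewrite actM -[X in 'P^*%act X _]/(b^-1 @: (b @: C)) imset_permK.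
  by have := abE C; rewrite !restr_normR.
move: Ab Aa; rewrite -groupV !mem_digraph_aut => /eqP Ab /eqP Aa.
by rewrite 2!digraph_actM Ab Aa.
Qed.
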